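(* Assume that $d(s,a)>0$ for every $(s,a)$, that $\alpha\in(0,1)$, and that $Q_0$ is deterministic. Let $(Q_k)_{k\ge0}$ be the i.i.d.-observation Q-learning iterates. Fix any $\varepsilon>0$ such that $\beta_\varepsilon:=\rho(\mathcal M_\alpha)+\varepsilon<1$, and let $V_\varepsilon^\infty$, $C_\varepsilon$ and $W_{\max}$ be as defined in the context. Then, for all $k\ge0$, $$\mathbb E[V_\varepsilon^\infty(Q_k-Q^* )]\le\beta_\varepsilon^{2k}V_\varepsilon^\infty(Q_0-Q^* )+\frac{\alpha^2C_\varepsilon^2W_{\max}}{1-\beta_\varepsilon^2}\left(1-\beta_\varepsilon^{2k}\right).$$ Consequently, for all $k\ge 0$, $$\mathbb E[\|Q_k-Q^*\|_\infty]\le\sqrt{C_\varepsilon}\,\beta_\varepsilon^k\|Q_0-Q^*\|_2+\alpha C_\varepsilon\sqrt{\frac{W_{\max}}{1-\beta_\varepsilon^2}}.$$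
   Context: MDP. A finite discounted MDP has state space $\mathcal S=\{1,\dots,|\mathcal S|\}$, action space $\mathcal A=\{1,\dots,|\mathcal A|\}$, transition probabilities $P(s'\mid s,a)$, real one-step rewards $r(s,a,s')$, and discount factor $\gamma\in(0,1)$. Put $R(s,a):=\sum_{s'}P(s'\mid s,a)r(s,a,s')$ and $R_{\max}:=\max_{s,a,s'}|r(s,a,s')|$. Q-functions are vectors $Q\in\mathbb R^{|\mathcal S||\mathcal A|}$ indexed by state-action pairs. $P$ also denotes the $(|\mathcal S||\mathcal A|)\times|\mathcal S|$ matrix whose row $(s,a)$ is $P(\cdot\mid s,a)$. A stochastic policy is a map $\mu$ from $\mathcal S$ to probability distributions on $\mathcal A$; $\Pi^\mu$ is the $|\mathcal S|\times(|\mathcal S||\mathcal A|)$ matrix with $(\Pi^\mu Q)(s)=\sum_a\mu(a\mid s)Q(s,a)$. $\Theta$ is the set of deterministic policies $\pi:\mathcal S\to\mathcal A$, identified with one-hot stochastic policies. $V_Q(s):=\max_aQ(s,a)$, $F(Q):=R+\gamma PV_Q$, and $Q^*$ is the unique fixed point of $F$. I.i.d.-observation Q-learning. At each time $k$, $(s_k,a_k)$ is sampled independently (of the past) with $\mathbb P(s_k=s,a_k=a)=d(s,a):=p(s)b(a\mid s)$, where $p$ is a distribution on $\mathcal S$ and $b$ a fixed behavior policy; then $s'_k\sim P(\cdot\mid s_k,a_k)$ and $r_{k+1}:=r(s_k,a_k,s'_k)$. With constant step-size $\alpha$, $Q_{k+1}(s_k,a_k)=Q_k(s_k,a_k)+\alpha\big(r_{k+1}+\gamma\max_uQ_k(s'_k,u)-Q_k(s_k,a_k)\big)$,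 and all other coordinates are unchanged. Matrices. $D:=\mathrm{diag}(d(s,a))$; $M_\pi:=I-\alpha D+\alpha\gamma DP\Pi^\pi$; $\mathcal M_\alpha:=\{M_\pi:\pi\in\Theta\}$. The joint spectral radius of a bounded set $\mathcal H$ of square matrices is $\rho(\mathcal H):=\lim_{k\to\infty}\sup_{A_1,\dots,A_k\in\mathcal H}\|A_k\cdots A_1\|^{1/k}$ (independent of the submultiplicative norm). Lyapunov function. For integers $t\ge0$ and $x\in\mathbb R^{|\mathcal S||\mathcal A|}$, $$V_\varepsilon^t(x):=\sum_{\ell=0}^{t}\beta_\varepsilon^{-2\ell}\max_{\pi_1,\dots,\pi_\ell\in\Theta}\|M_{\pi_\ell}\cdots M_{\pi_1}x\|_2^2,$$ where the $\ell=0$ term is $\|x\|_2^2$, and $V_\varepsilon^\infty(x):=\lim_{t\to\infty}V_\varepsilon^t(x)$. When $\beta_\varepsilon<1$, $V_\varepsilon^\infty$ is finite and $C_\varepsilon\ge1$ denotes a constant (one exists) such that $\|x\|_2^2\le V_\varepsilon^\infty(x)\le C_\varepsilon\|x\|_2^2$ for all $x$. Noise bound. $W_{\max}:=\big(R_{\max}+(1+\gamma)\max\{\|Q_0\|_\infty,\tfrac{R_{\max}}{1-\gamma}\}\big)^2$. *)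

(* Defs.v *)
From HB Require Import structures.
From mathcomp Require Import all_boot all_order all_algebra.
From mathcomp Require Import all_classical all_reals all_analysis.
Import Order.TTheory GRing.Theory Num.Theory.
Import numFieldNormedType.Exports.

Set Implicit Arguments.
Unset Strict Implicit.
Unset Printing Implicit Defensive.

Local Open Scope classical_set_scope.
Local Open Scope ring_scope.

Definition is_distr {R : realType} {I : finType} (p : I -> R) : Prop :=
  (forall i, 0 <= p i) /\ \sum_i p i = 1.

(* States are 'I_nS.+1 and actions 'I_nA.+1: both sets are nonempty. *)
Record mdp (R : realType) (nS nA : nat) := Mdp {
  trans : 'I_nS.+1 -> 'I_nA.+1 -> 'I_nS.+1 -> R;
  reward : 'I_nS.+1 -> 'I_nA.+1 -> 'I_nS.+1 -> R;
  discount : R;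
  trans_distr : forall s a, is_distr (trans s a);
  discount_gt0 : 0 < discount;
  discount_lt1 : discount < 1 }.

(* Vectors of R^(|S||A|) are column vectors; the coordinate of the pair (s, a)
   is the one of index [mxvec_index s a]. The library norm `|x| of such a vector
   is its sup norm, the largest absolute value of an entry. *)
Notation sa_vec R nS nA := 'cV[R]_(nS.+1 * nA.+1).

(* One step of the chain: (s_k, a_k, s'_k). *)
Notation sample nS nA := ('I_nS.+1 * 'I_nA.+1 * 'I_nS.+1)%type.

Definition at_sa {R : realType} {nS nA : nat} (Q : sa_vec R nS nA)
  (s : 'I_nS.+1) (a : 'I_nA.+1) : R := Q (mxvec_index s a) 0.

Definition of_sa {R : realType} {nS nA : nat}
  (f : 'I_nS.+1 -> 'I_nA.+1 -> R) : sa_vec R nS nA :=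
  (mxvec (\matrix_(s, a) f s a))^T.

Lemma of_saK {R : realType} {nS nA : nat} (f : 'I_nS.+1 -> 'I_nA.+1 -> R) s a :
  at_sa (of_sa f) s a = f s a.
Proof. by rewrite /at_sa /of_sa mxE mxvecE mxE. Qed.

Definition norm2 {R : realType} {n : nat} (x : 'cV[R]_n) : R :=
  Num.sqrt (\sum_i x i 0 ^+ 2).

Definition mean_reward {R : realType} {nS nA : nat} (M : mdp R nS nA)
  (s : 'I_nS.+1) (a : 'I_nA.+1) : R :=
  \sum_s' trans M s a s' * reward M s a s'.

Definition reward_max {R : realType} {nS nA : nat} (M : mdp R nS nA) : R :=
  \big[Num.max/0]_s \big[Num.max/0]_a \big[Num.max/0]_s' `|reward M s a s'|.

(* The maximum over actions is seeded with the value at action 0. *)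
Definition greedy_value {R : realType} {nS nA : nat} (Q : sa_vec R nS nA)
  (s : 'I_nS.+1) : R :=
  \big[Num.max/at_sa Q s ord0]_a at_sa Q s a.

Definition trans_mx {R : realType} {nS nA : nat} (M : mdp R nS nA) :
  'M[R]_(nS.+1 * nA.+1, nS.+1) :=
  \matrix_(i, s') of_sa (fun s a => trans M s a s') i 0.

Definition bellman {R : realType} {nS nA : nat} (M : mdp R nS nA)
  (Q : sa_vec R nS nA) : sa_vec R nS nA :=
  of_sa (mean_reward M)
  + discount M *: (trans_mx M *m \col_s greedy_value Q s).

Definition policy_mx {R : realType} {nS nA : nat}
  (mu : 'I_nS.+1 -> 'I_nA.+1 -> R) : 'M[R]_(nS.+1, nS.+1 * nA.+1) :=
  \matrix_(s, i) of_sa (fun s1 a => (s1 == s)%:R * mu s a) i 0.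

Lemma policy_mxE {R : realType} {nS nA : nat}
    (mu : 'I_nS.+1 -> 'I_nA.+1 -> R) (Q : sa_vec R nS nA) s :
  (policy_mx mu *m Q) s 0 = \sum_a mu s a * at_sa Q s a.
Proof.
rewrite mxE (reindex _ (curry_mxvec_bij _ _)) /=.
rewrite (eq_bigr (fun sa => policy_mx mu s (mxvec_index sa.1 sa.2)
                            * at_sa Q sa.1 sa.2)) => [|[] //].
rewrite -(pair_bigA _ (fun s1 a => policy_mx mu s (mxvec_index s1 a)
                                   * at_sa Q s1 a)) /=.
rewrite (bigD1 s) //= [X in _ + X]big1 ?addr0 => [|s1 /negPf s1s].
  by apply: eq_bigr => a _; rewrite mxE [of_sa _ _ _]of_saK eqxx mul1r.
by apply: big1 => a _; rewrite mxE [of_sa _ _ _]of_saK s1s !mul0r.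
Qed.

Notation det_policy nS nA := {ffun 'I_nS.+1 -> 'I_nA.+1}.

Definition one_hot {R : realType} {nS nA : nat} (pi : det_policy nS nA)
  (s : 'I_nS.+1) (a : 'I_nA.+1) : R := (a == pi s)%:R.

Definition visit {R : realType} {nS nA : nat}
  (p : 'I_nS.+1 -> R) (b : 'I_nS.+1 -> 'I_nA.+1 -> R)
  (s : 'I_nS.+1) (a : 'I_nA.+1) : R := p s * b s a.

Definition switch_mx {R : realType} {nS nA : nat} (M : mdp R nS nA)
  (d : 'I_nS.+1 -> 'I_nA.+1 -> R) (alpha : R) (pi : det_policy nS nA) :
  'M[R]_(nS.+1 * nA.+1) :=
  let D := diag_mx (of_sa d)^T in
  1%:M - alpha *: D
  + (alpha * discount M) *: (D *m trans_mx M *m policy_mx (one_hot pi)).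

(* [mxprod [:: A_1; ...; A_k]] is A_k *m ... *m A_1. *)
Definition mxprod {R : realType} {n : nat} (s : seq 'M[R]_n) : 'M[R]_n :=
  foldl (fun B A => A *m B) 1%:M s.

(* The operator norm induced by the sup norm: a submultiplicative norm. *)
Definition mx_opnorm {R : realType} {n : nat} (A : 'M[R]_n) : R :=
  \big[Num.max/0]_i \sum_j `|A i j|.

Definition joint_spectral_radius {R : realType} {n : nat}
  (H : set 'M[R]_n) : R :=
  limn (fun k => sup [set mx_opnorm (mxprod s) `^ k%:R^-1 |
    s in [set s : seq 'M[R]_n | size s = k /\ forall A, A \in s -> H A]]).

Definition lyap {R : realType} {nS nA : nat} (M : mdp R nS nA)
  (d : 'I_nS.+1 -> 'I_nA.+1 -> R) (alpha beta : R) (t : nat)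
  (x : sa_vec R nS nA) : R :=
  \sum_(l < t.+1) beta ^- (2 * l) *
    \big[Num.max/0]_(pis : l.-tuple (det_policy nS nA))
      norm2 (mxprod [seq switch_mx M d alpha pi | pi <- pis] *m x) ^+ 2.

(* The limit of a nondecreasing sequence, hence taken in [0, +oo]. *)
Definition lyap_oo {R : realType} {nS nA : nat} (M : mdp R nS nA)
  (d : 'I_nS.+1 -> 'I_nA.+1 -> R) (alpha beta : R)
  (x : sa_vec R nS nA) : \bar R :=
  limn (fun t => (lyap M d alpha beta t x)%:E).

Definition noise_bound {R : realType} {nS nA : nat} (M : mdp R nS nA)
  (Q0 : sa_vec R nS nA) : R :=
  (reward_max M + (1 + discount M)
    * Num.max (`|Q0|) (reward_max M / (1 - discount M))) ^+ 2.

Definition q_update {R : realType} {nS nA : nat} (M : mdp R nS nA) (alpha : R)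
  (Q : sa_vec R nS nA) (z : sample nS nA) : sa_vec R nS nA :=
  let: (sk, ak, sk') := z in
  of_sa (fun s a =>
    if (s == sk) && (a == ak) then
      at_sa Q sk ak + alpha * (reward M sk ak sk'
        + discount M * greedy_value Q sk' - at_sa Q sk ak)
    else at_sa Q s a).

Fixpoint q_iter {R : realType} {nS nA : nat} (M : mdp R nS nA) (alpha : R)
  (Q0 : sa_vec R nS nA) (z : nat -> sample nS nA) (k : nat) : sa_vec R nS nA :=
  if k is j.+1 then q_update M alpha (q_iter M alpha Q0 z j) (z j) else Q0.

(* The events of the sigma-algebra generated by Z_0, ..., Z_{k-1}; no closure
   is needed since the variables take finitely many values. *)
Definition past_event {T X : Type} (Z : nat -> T -> X) (k : nat)
  (E : set T) : Prop :=
  exists B : set ('I_k -> X), E = [set w | B (fun i => Z i w)].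

(* Z_k = (s_k, a_k, s'_k), where (s_k, a_k) has law d and is independent of the
   past, and s'_k has law P(. | s_k, a_k) conditionally on the past and
   (s_k, a_k). *)
Record iid_observations {R : realType} {nS nA : nat} (M : mdp R nS nA)
    (d : 'I_nS.+1 -> 'I_nA.+1 -> R) {disp : measure_display}
    {T : measurableType disp} (Pr : probability T R)
    (Z : nat -> T -> sample nS nA) : Prop := IidObservations {
  obs_measurable : forall k z, measurable [set w | Z k w = z];
  obs_pair : forall k E s a, past_event Z k E ->
    Pr (E `&` [set w | (Z k w).1 = (s, a)]) = (Pr E * (d s a)%:E)%E;
  obs_next : forall k E s a s', past_event Z k E ->
    Pr (E `&` [set w | (Z k w).1 = (s, a)] `&` [set w | (Z k w).2 = s'])
    = (Pr (E `&` [set w | (Z k w).1 = (s, a)]) * (trans M s a s')%:E)%E }.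

(* Main.v *)
(* Write the update as Q_{k+1} - Q* = y + alpha u, where y is the expected step
   and u the centred noise. Since max_a Q - max_a Q* is a convex combination of
   the entries of Q - Q* in each state, y is a convex combination of the vectors
   M_pi (Q_k - Q* ). The function V_oo is convex and satisfies
   V_oo(M_pi x) <= beta^2 (V_oo(x) - ||x||^2) <= beta^2 (1 - 1/C) V_oo(x), and
   Young's inequality V_oo(y + alpha u) <= (1 + e) V_oo(y)
   + (1 + 1/e) V_oo(alpha u) with e = 1 / (C - 1) (if C = 1 then y = 0) yields
   beta^2 V_oo(x) + alpha^2 C^2 ||u||^2. As V_oo is not quadratic, E u = 0 would
   not remove a first-order term; the slack ||x||^2 in the drift pays for it
   instead. Centring only serves to bound E ||u||^2, a variance, by the second
   moment of the temporal difference. Iterating gives the first bound, and the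
   Cauchy-Schwarz inequality the second. *)
Require Import Defs.
From HB Require Import structures.
From mathcomp Require Import all_boot all_order all_algebra.
From mathcomp Require Import all_classical all_reals all_analysis.
From mathcomp Require Import measurable_realfun ring lra.
Import Order.TTheory GRing.Theory Num.Theory.
Import numFieldNormedType.Exports.

Set Implicit Arguments.
Unset Strict Implicit.
Unset Printing Implicit Defensive.

Local Open Scope classical_set_scope.
Local Open Scope ring_scope.

(** * Means and variances under a finite distribution *)

Section FiniteDistributions.
Context {R : realType} {I : finType}.
Implicit Types (p a f : I -> R).

Lemma variance_distrE p a : is_distr p ->
  \sum_i p i * (a i - \sum_j p j * a j) ^+ 2
  = \sum_i p i * a i ^+ 2 - (\sum_i p i * a i) ^+ 2.
Proof.
move=> [_ p1]; set m := \sum_j p j * a j.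
rewrite (eq_bigr (fun i => p i * a i ^+ 2 - 2 * m * (p i * a i)
                           + m ^+ 2 * p i)) => [|i _]; last by ring.
rewrite big_split /= sumrB -!mulr_sumr p1 -/m; ring.
Qed.

Lemma sqr_mean_le p a : is_distr p ->
  (\sum_i p i * a i) ^+ 2 <= \sum_i p i * a i ^+ 2.
Proof.
move=> dp; rewrite -subr_ge0 -variance_distrE //.
by apply: sumr_ge0 => i _; rewrite mulr_ge0 ?sqr_ge0 // dp.1.
Qed.

Lemma variance_le p a : is_distr p ->
  \sum_i p i * (a i - \sum_j p j * a j) ^+ 2 <= \sum_i p i * a i ^+ 2.
Proof. by move=> dp; rewrite variance_distrE // gerBl sqr_ge0. Qed.

Lemma mean_le p a c : is_distr p -> (forall i, a i <= c) ->
  \sum_i p i * a i <= c.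
Proof.
move=> [p0 p1] ac; rewrite -[leRHS]mul1r -p1 mulr_suml.
by apply: ler_sum => i _; exact: ler_wpM2l.
Qed.

End FiniteDistributions.

(** * Convex combinations and Young's inequality for real numbers *)

Lemma between_convex {R : realType} (u v w : R) : u <= v <= w ->
  exists2 t, 0 <= t <= 1 & v = t * w + (1 - t) * u.
Proof.
move=> /andP[uv vw]; have [uw|uw] := eqVneq u w.
  by exists 0; [rewrite lexx ler01|lra].
have {}uw : 0 < w - u by rewrite subr_gt0 lt_neqAle uw (le_trans uv).
exists ((v - u) / (w - u)).
  by rewrite divr_ge0 ?subr_ge0 ?(le_trans uv) //= ler_pdivrMr // mul1r lerB.
by field; rewrite gt_eqF.
Qed.

Lemma young_sqr {R : realType} (e a b : R) : 0 < e ->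
  (a + b) ^+ 2 <= (1 + e) * a ^+ 2 + (1 + e^-1) * b ^+ 2.
Proof.
move=> e0; rewrite -subr_ge0.
rewrite (_ : _ - _ = e^-1 * (e * a - b) ^+ 2); last by field; rewrite gt_eqF.
by rewrite mulr_ge0 ?sqr_ge0 // invr_ge0 ltW.
Qed.

(** * Randomized policies as mixtures of deterministic ones *)

Section ProductPolicy.
Context {R : realType} {S A : finType} (mu : S -> A -> R).
Hypothesis mu_distr : forall s, is_distr (mu s).

(** The law of the deterministic policy obtained by drawing the action of each state independently
    from [mu]. *)
Definition prod_weight (pi : {ffun S -> A}) : R := \prod_s mu s (pi s).

Lemma prod_weight_distr : is_distr prod_weight.
Proof.
split=> [pi|]; first by apply: prodr_ge0 => s _; case: (mu_distr s).
rewrite /prod_weight -(bigA_distr_bigA (fun s a => mu s a)).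
by apply: big1 => s _; case: (mu_distr s).
Qed.

Lemma prod_weight_marginal s (f : A -> R) :
  \sum_pi prod_weight pi * f (pi s) = \sum_a mu s a * f a.
Proof.
(* With the value 1 at all states other than [s], [f (pi s)] becomes a product over states, and the
   sum over [pi] factorizes state by state. *)
pose g s' a := if s' == s then f a else 1.
have gE (pi : {ffun S -> A}) : \prod_s' g s' (pi s') = f (pi s).
  rewrite (bigD1 s) //= /g eqxx big1 ?mulr1 // => s' /negPf ->.
  by [].
under eq_bigr => pi _ do rewrite -gE -big_split /=.
rewrite -(bigA_distr_bigA (fun s' a => mu s' a * g s' a)).
rewrite (bigD1 s) //= [X in _ * X]big1 ?mulr1 /g ?eqxx // => s' /negPf ->.
under eq_bigr => a _ do rewrite mulr1.
by case: (mu_distr s').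
Qed.

End ProductPolicy.

(** * Euclidean norm and sup norm *)

Section SquaredNorm.
Context {R : realType} {n : nat}.
Implicit Types x y : 'cV[R]_n.

Lemma norm2_sqr x : norm2 x ^+ 2 = \sum_i x i 0 ^+ 2.
Proof. by rewrite sqr_sqrtr // sumr_ge0 // => i _; exact: sqr_ge0. Qed.

Lemma norm2_sqr_convex (I : finType) (p : I -> R) (x : I -> 'cV[R]_n) :
  is_distr p ->
  norm2 (\sum_i p i *: x i) ^+ 2 <= \sum_i p i * norm2 (x i) ^+ 2.
Proof.
move=> dp; rewrite norm2_sqr.
under [leRHS]eq_bigr => i _ do rewrite norm2_sqr mulr_sumr.
rewrite exchange_big /=; apply: ler_sum => j _; rewrite summxE.
under [in leLHS]eq_bigr => i _ do rewrite mxE.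
exact: sqr_mean_le.
Qed.

Lemma norm2_sqr_young (e : R) x y : 0 < e ->
  norm2 (x + y) ^+ 2 <= (1 + e) * norm2 x ^+ 2 + (1 + e^-1) * norm2 y ^+ 2.
Proof.
move=> e0; rewrite !norm2_sqr !mulr_sumr -big_split /=.
by apply: ler_sum => i _; rewrite mxE young_sqr.
Qed.

Lemma norm2Z_sqr (c : R) x : norm2 (c *: x) ^+ 2 = c ^+ 2 * norm2 x ^+ 2.
Proof.
by rewrite !norm2_sqr mulr_sumr; apply: eq_bigr => i _; rewrite mxE exprMn.
Qed.

Lemma norm2_sqr_eq0 x : norm2 x ^+ 2 <= 0 -> x = 0.
Proof.
rewrite norm2_sqr => x0; apply/colP => i; rewrite mxE; apply/eqP.
rewrite -sqrf_eq0 eq_le sqr_ge0 andbT (le_trans _ x0) //.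
by rewrite (bigD1 i) //= lerDl sumr_ge0 // => j _; exact: sqr_ge0.
Qed.

End SquaredNorm.

Lemma le_mx_norm {R : realType} {m n : nat} (x : 'M[R]_(m.+1, n.+1)) i j :
  `|x i j| <= `|x|.
Proof.
rewrite [`|x|]mx_normrE.
exact: (le_bigmax _ (fun ij => `|x ij.1 ij.2|) (i, j)).
Qed.

Lemma mx_norm_le {R : realType} {m n : nat} (x : 'M[R]_(m.+1, n.+1)) c :
  0 <= c -> (forall i j, `|x i j| <= c) -> `|x| <= c.
Proof. by move=> c0 xc; rewrite [`|x|]mx_normrE; apply: bigmax_le. Qed.

Lemma mx_norm_le_norm2 {R : realType} {n : nat} (x : 'cV[R]_n.+1) :
  `|x| ^+ 2 <= norm2 x ^+ 2.
Proof.
rewrite ler_sqr ?nnegrE ?sqrtr_ge0 //.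
apply: mx_norm_le => [|i j]; first exact: sqrtr_ge0.
rewrite (ord1 j) -sqrtr_sqr ler_sqrt ?sumr_ge0 // => [|k _];
  last exact: sqr_ge0.
by rewrite (bigD1 i) //= lerDl sumr_ge0 // => k _; exact: sqr_ge0.
Qed.

(** * Matrix products and the joint spectral radius *)

Lemma mxprod_cons {R : realType} {n : nat} (A : 'M[R]_n) (s : seq 'M[R]_n) :
  mxprod (A :: s) = mxprod s *m A.
Proof.
rewrite /mxprod /= mulmx1.
(* The induction needs a free accumulator: the claim becomes that starting the fold from [B0 *m A]
   amounts to starting it from [B0] and multiplying by [A] on the right. *)
have: A = 1%:M *m A by rewrite mul1mx.
move: {1 3}A 1%:M => B B0 ->; elim: s B0 => //= A' s IH B0.
by rewrite mulmxA IH.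
Qed.

Lemma joint_spectral_radius_ge0 {R : realType} {n : nat} (H : set 'M[R]_n) :
  0 <= joint_spectral_radius H.
Proof.
rewrite /joint_spectral_radius; set u := fun k : nat => _.
have u0 k : 0 <= u k.
  rewrite /u; set E := [set _ | _ in _].
  (* A set that is empty or unbounded above has [sup] equal to 0; otherwise one member suffices, all
     members being nonnegative. *)
  have [[[e Ee] ubE]|/sup_out ->] := pselect (has_sup E); last exact: lexx.
  apply: le_trans (ub_le_sup ubE Ee).
  by case: Ee => s _ <-; exact: powR_ge0.
(* Without convergence the library limit is the default point 0. *)
have [cu|/dvgP ->] := pselect (cvgn u); last exact: lexx.
by apply: limr_ge => //; exact: nearW.
Qed.

(** * State-action vectors and differences of greedy values *)

Section StateActionVectors.
Context {R : realType} {nS nA : nat}.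
Implicit Types (x Q : sa_vec R nS nA) (s : 'I_nS.+1) (a : 'I_nA.+1) (c : R).

Lemma sa_vecP x y : (forall s a, at_sa x s a = at_sa y s a) <-> x = y.
Proof.
split=> [xy|-> //]; apply/colP => i.
by case/mxvec_indexP: i => s a; exact: xy.
Qed.

Lemma at_saD x y s a : at_sa (x + y) s a = at_sa x s a + at_sa y s a.
Proof. by rewrite /at_sa mxE. Qed.

Lemma at_saN x s a : at_sa (- x) s a = - at_sa x s a.
Proof. by rewrite /at_sa mxE. Qed.

Lemma at_saB x y s a : at_sa (x - y) s a = at_sa x s a - at_sa y s a.
Proof. by rewrite at_saD at_saN. Qed.

Lemma at_saZ c x s a : at_sa (c *: x) s a = c * at_sa x s a.
Proof. by rewrite /at_sa mxE. Qed.

Lemma at_sa_sum (I : finType) (x : I -> sa_vec R nS nA) s a :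
  at_sa (\sum_i x i) s a = \sum_i at_sa (x i) s a.
Proof. by rewrite /at_sa summxE. Qed.

Lemma norm2_sqr_sa x : norm2 x ^+ 2 = \sum_s \sum_a at_sa x s a ^+ 2.
Proof.
rewrite norm2_sqr (reindex _ (curry_mxvec_bij _ _)) /=.
by rewrite pair_bigA /=; apply: eq_bigr => -[].
Qed.

Lemma le_at_sa_norm x s a : `|at_sa x s a| <= `|x|.
Proof. exact: le_mx_norm. Qed.

Lemma sa_norm_le x c : 0 <= c -> (forall s a, `|at_sa x s a| <= c) -> `|x| <= c.
Proof.
move=> c0 xc; have {}xc (i : 'I_(nS.+1 * nA.+1)) : `|x i 0| <= c.
  by case/mxvec_indexP: i => s a; exact: xc.
by apply: mx_norm_le => // i j; rewrite (ord1 j).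
Qed.

Lemma greedy_value_ge Q s a : at_sa Q s a <= greedy_value Q s.
Proof. exact: le_bigmax. Qed.

Lemma greedy_value_attained Q s : exists a, greedy_value Q s = at_sa Q s a.
Proof.
rewrite /greedy_value; elim/big_ind: _ => [|u v [a ->] [a' ->]|a _].
- by exists ord0.
- by rewrite maxEle; case: ifP => _; [exists a'|exists a].
- by exists a.
Qed.

Lemma norm_greedy_value_le Q s : `|greedy_value Q s| <= `|Q|.
Proof. by have [a ->] := greedy_value_attained Q s; exact: le_at_sa_norm. Qed.

(* The mixture of an action greedy for Q and one greedy for Q': the difference
   of the maxima lies between the differences at these two actions. *)
Lemma greedy_value_sub_mixture Q Q' s : exists2 m : 'I_nA.+1 -> R,
  is_distr m &
  greedy_value Q s - greedy_value Q' s = \sum_a m a * at_sa (Q - Q') s a.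
Proof.
have [a1 Qa1] := greedy_value_attained Q s.
have [a2 Qa2] := greedy_value_attained Q' s.
have [|t /andP[t0 t1] tE] := @between_convex R (at_sa (Q - Q') s a2)
    (greedy_value Q s - greedy_value Q' s) (at_sa (Q - Q') s a1).
  rewrite !at_saB -Qa1 -Qa2 lerD2r lerD2l lerN2.
  by rewrite !greedy_value_ge.
have sum_delta (f : 'I_nA.+1 -> R) a0 : \sum_a (a == a0)%:R * f a = f a0.
  rewrite (bigD1 a0) //= eqxx mul1r big1 ?addr0 // => a /negPf ->.
  by rewrite mul0r.
have mix (f : 'I_nA.+1 -> R) :
    \sum_a (t * (a == a1)%:R + (1 - t) * (a == a2)%:R) * f a
    = t * f a1 + (1 - t) * f a2.
  under eq_bigr => a _ do rewrite mulrDl -!mulrA.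
  by rewrite big_split /= -!mulr_sumr !sum_delta.
exists (fun a => t * (a == a1)%:R + (1 - t) * (a == a2)%:R);
  last by rewrite mix.
split=> [a|]; first by rewrite addr_ge0 // mulr_ge0 ?ler0n // subr_ge0.
have := mix (fun=> 1); rewrite -mulr_suml mulr1 => ->; lra.
Qed.

(** The two-action mixture varies with the state. The product law has all these mixtures as
    marginals, so a single distribution over policies serves every state at once. *)
Lemma greedy_value_sub_policies Q Q' : exists2 w : det_policy nS nA -> R,
  is_distr w &
  forall s, greedy_value Q s - greedy_value Q' s
            = \sum_pi w pi * at_sa (Q - Q') s (pi s).
Proof.
have /choice[mu muP] : forall s, exists m : 'I_nA.+1 -> R, is_distr m /\
  greedy_value Q s - greedy_value Q' s = \sum_a m a * at_sa (Q - Q') s a.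
  by move=> s; have [m] := greedy_value_sub_mixture Q Q' s; exists m.
have mu_distr s : is_distr (mu s) by case: (muP s).
exists (prod_weight mu) => [|s]; first exact: prod_weight_distr.
rewrite (prod_weight_marginal mu_distr s (fun a => at_sa (Q - Q') s a)).
by case: (muP s).
Qed.

End StateActionVectors.

(** * The Q-learning step: boundedness, mean and variance *)

Section Mdp.
Context {R : realType} {nS nA : nat} (M : mdp R nS nA).
Implicit Types (x Q : sa_vec R nS nA) (d : 'I_nS.+1 -> 'I_nA.+1 -> R).
Implicit Types (s : 'I_nS.+1) (a : 'I_nA.+1) (alpha : R).

Lemma trans_mulE (v : 'cV[R]_nS.+1) s a :
  at_sa (trans_mx M *m v) s a = \sum_s' trans M s a s' * v s' 0.
Proof.
rewrite /at_sa mxE; apply: eq_bigr => s' _; congr (_ * _).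
by rewrite mxE [LHS]of_saK.
Qed.

Lemma bellmanE Q s a : at_sa (bellman M Q) s a =
  mean_reward M s a + discount M * \sum_s' trans M s a s' * greedy_value Q s'.
Proof.
rewrite at_saD of_saK at_saZ trans_mulE; congr (_ + _ * _).
by apply: eq_bigr => s' _; rewrite mxE.
Qed.

Lemma diag_mulE d x s a :
  at_sa (diag_mx (of_sa d)^T *m x) s a = d s a * at_sa x s a.
Proof. by rewrite /at_sa mul_diag_mx !mxE mxvecE mxE. Qed.

Lemma one_hot_mulE (pi : det_policy nS nA) x s :
  (policy_mx (one_hot pi) *m x) s 0 = at_sa x s (pi s).
Proof.
rewrite policy_mxE (bigD1 (pi s)) //= /one_hot eqxx mul1r big1 ?addr0 //.
by move=> a /negPf ->; rewrite mul0r.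
Qed.

Lemma switch_mulE d alpha (pi : det_policy nS nA) x s a :
  at_sa (switch_mx M d alpha pi *m x) s a =
  at_sa x s a - alpha * (d s a * at_sa x s a)
  + alpha * discount M *
    (d s a * \sum_s' trans M s a s' * at_sa x s' (pi s')).
Proof.
rewrite /switch_mx !mulmxDl mulNmx mul1mx -!scalemxAl -!mulmxA.
rewrite at_saD at_saB !at_saZ !diag_mulE trans_mulE.
by under eq_bigr => s' _ do rewrite one_hot_mulE.
Qed.

Lemma le_reward_max s a s' : `|reward M s a s'| <= reward_max M.
Proof.
rewrite /reward_max; apply: le_trans (le_bigmax _ _ s).
by apply: le_trans (le_bigmax _ _ a); exact: le_bigmax.
Qed.

Lemma reward_max_ge0 : 0 <= reward_max M.
Proof. exact: le_trans (le_reward_max ord0 ord0 ord0). Qed.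

Definition td_error Q (z : sample nS nA) : R :=
  reward M z.1.1 z.1.2 z.2 + discount M * greedy_value Q z.2
  - at_sa Q z.1.1 z.1.2.

Definition td_step Q (z : sample nS nA) : sa_vec R nS nA :=
  of_sa (fun s a => ((s == z.1.1) && (a == z.1.2))%:R * td_error Q z).

Lemma q_updateE alpha Q z : q_update M alpha Q z = Q + alpha *: td_step Q z.
Proof.
case: z => -[sk ak] sk'; apply/sa_vecP => s a.
rewrite at_saD at_saZ !of_saK /td_error /=.
have [->|_] /= := eqVneq s sk; last by rewrite mul0r mulr0 addr0.
by have [->|_] /= := eqVneq a ak; rewrite (mul1r, mul0r) ?mulr0 ?addr0.
Qed.

Lemma norm_td_error_le Q z :
  `|td_error Q z| <= reward_max M + (1 + discount M) * `|Q|.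
Proof.
have g0 := ltW (discount_gt0 M).
rewrite (le_trans (ler_normB _ _)) // mulrDl mul1r [leRHS]addrCA [leRHS]addrC.
rewrite lerD ?le_at_sa_norm // (le_trans (ler_normD _ _)) //.
rewrite lerD ?le_reward_max // normrM (ger0_norm g0).
by rewrite ler_wpM2l // norm_greedy_value_le.
Qed.

(** The updated entry is a convex combination of the old entry and a target of size at most (1 -
    gamma) c + gamma c = c, so the sup-norm ball of radius [c] is invariant. *)
Lemma q_update_norm_le alpha Q z c : 0 <= alpha <= 1 ->
  reward_max M / (1 - discount M) <= c -> `|Q| <= c ->
  `|q_update M alpha Q z| <= c.
Proof.
move=> /andP[a0 a1] rc Qc; have g0 := ltW (discount_gt0 M).
have g1 : 0 < 1 - discount M by rewrite subr_gt0 discount_lt1.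
have c0 : 0 <= c by apply: le_trans Qc.
case: z => -[sk ak] sk'; apply: sa_norm_le => // s a.
rewrite of_saK; case: ifP => _; last first.
  exact: le_trans (le_at_sa_norm _ _ _) Qc.
set r := reward _ _ _ _; set q := at_sa _ _ _; set v := greedy_value _ _.
have rle : `|r| <= (1 - discount M) * c.
  rewrite (le_trans (le_reward_max _ _ _)) // mulrC.
  by rewrite -ler_pdivrMr.
have qc : `|q| <= c by exact: le_trans (le_at_sa_norm _ _ _) Qc.
have vc : `|v| <= c by exact: le_trans (norm_greedy_value_le _ _) Qc.
have -> : q + alpha * (r + discount M * v - q)
    = (1 - alpha) * q + alpha * (r + discount M * v) by ring.
have -> : c = (1 - alpha) * c + alpha * ((1 - discount M) * c + discount M * c).
  by ring.
rewrite (le_trans (ler_normD _ _)) // lerD // normrM.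
  by rewrite ger0_norm ?subr_ge0 // ler_wpM2l ?subr_ge0.
rewrite ger0_norm // ler_wpM2l // (le_trans (ler_normD _ _)) // lerD //.
by rewrite normrM ger0_norm // ler_wpM2l.
Qed.

Lemma q_iter_norm_le alpha Q0 (z : nat -> sample nS nA) k : 0 <= alpha <= 1 ->
  `|q_iter M alpha Q0 z k|
  <= Num.max `|Q0| (reward_max M / (1 - discount M)).
Proof.
move=> a01; elim: k => [|k IH] /=; first by rewrite le_max lexx.
by apply: q_update_norm_le; rewrite // le_max lexx orbT.
Qed.

Lemma q_iter_eq alpha Q0 (z z' : nat -> sample nS nA) k :
  (forall i, (i < k)%N -> z i = z' i) ->
  q_iter M alpha Q0 z k = q_iter M alpha Q0 z' k.
Proof.
elim: k => //= k IH zz'; rewrite zz' // IH // => i ik.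
by apply: zz'; exact: ltnW.
Qed.

Definition sample_law d (z : sample nS nA) : R :=
  d z.1.1 z.1.2 * trans M z.1.1 z.1.2 z.2.

Lemma sample_law_sum d (f : sample nS nA -> R) :
  \sum_z sample_law d z * f z =
  \sum_s \sum_a d s a * \sum_s' trans M s a s' * f (s, a, s').
Proof.
rewrite pair_bigA /=; under [RHS]eq_bigr => sa _ do rewrite mulr_sumr.
by rewrite pair_bigA /=; apply: eq_bigr => -[[s a] s'] _; rewrite mulrA.
Qed.

Lemma sample_law_distr p b : is_distr p -> (forall s, is_distr (b s)) ->
  is_distr (sample_law (visit p b)).
Proof.
move=> [p0 p1] bd; split=> [z|].
  rewrite mulr_ge0 ?mulr_ge0 //; first by case: (bd z.1.1).
  by case: (trans_distr M z.1.1 z.1.2).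
have := sample_law_sum (visit p b) (fun=> 1).
rewrite -mulr_suml mulr1 => ->; rewrite -[RHS]p1; apply: eq_bigr => s _.
have tE a : \sum_s' trans M s a s' * 1 = 1.
  by rewrite -mulr_suml (trans_distr M s a).2 mulr1.
under eq_bigr => a _ do rewrite tE mulr1.
by rewrite -mulr_sumr (bd s).2 mulr1.
Qed.

Definition mean_td_step d Q : sa_vec R nS nA :=
  \sum_z sample_law d z *: td_step Q z.

(** The mean increment is D (F(Q) - Q): only samples starting at (s, a) move this entry, and they
    have total mass [d s a]. *)
Lemma mean_td_stepE d Q s a : at_sa (mean_td_step d Q) s a =
  d s a * (at_sa (bellman M Q) s a - at_sa Q s a).
Proof.
rewrite /mean_td_step at_sa_sum.
under eq_bigr => z _ do rewrite at_saZ of_saK.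
rewrite sample_law_sum (bigD1 s) //= [X in _ + X]big1 ?addr0; last first.
  move=> s1 /negPf s1s; apply: big1 => a1 _.
  by rewrite big1 ?mulr0 // => s' _; rewrite eq_sym s1s mul0r mulr0.
rewrite (bigD1 a) //= [X in _ + X]big1 ?addr0; last first.
  move=> a1 /negPf a1a.
  by rewrite big1 ?mulr0 // => s' _; rewrite eqxx eq_sym a1a mul0r mulr0.
rewrite bellmanE /mean_reward; congr (_ * _).
have <- : \sum_s' trans M s a s' * at_sa Q s a = at_sa Q s a.
  by rewrite -mulr_suml (trans_distr M s a).2 mul1r.
rewrite mulr_sumr.
rewrite -big_split -sumrB /=; apply: eq_bigr => s' _.
by rewrite /td_error /= !eqxx mul1r; ring.
Qed.

Lemma mean_step_error d alpha Q Qstar : bellman M Qstar = Qstar ->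
  exists2 w : det_policy nS nA -> R, is_distr w &
    Q + alpha *: mean_td_step d Q - Qstar =
    \sum_pi w pi *: (switch_mx M d alpha pi *m (Q - Qstar)).
Proof.
move=> /sa_vecP QstarE.
have [w wd wE] := greedy_value_sub_policies Q Qstar; exists w => //.
apply/sa_vecP => s a; rewrite at_sa_sum.
under eq_bigr => pi _ do rewrite at_saZ switch_mulE mulrDr.
rewrite big_split /= -mulr_suml wd.2 mul1r.
have -> : \sum_pi w pi * (alpha * discount M * (d s a *
      \sum_s' trans M s a s' * at_sa (Q - Qstar) s' (pi s')))
    = alpha * discount M * (d s a *
      \sum_s' trans M s a s' * (greedy_value Q s' - greedy_value Qstar s')).
  under eq_bigr => pi _ do rewrite mulrCA [w pi * _]mulrCA mulr_sumr.
  rewrite -!mulr_sumr exchange_big /=; congr (_ * (_ * _)).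
  apply: eq_bigr => s' _; rewrite wE mulr_sumr.
  by apply: eq_bigr => pi _; rewrite mulrCA.
under eq_bigr => s' _ do rewrite mulrBr.
rewrite sumrB !at_saB at_saD at_saZ mean_td_stepE bellmanE.
have := QstarE s a; rewrite bellmanE => <-; ring.
Qed.

(** In each coordinate the variance is at most the second moment. Every [td_step] has at most one
    nonzero entry, the temporal difference, so no dimension factor appears. *)
Lemma td_step_variance d Q : is_distr (sample_law d) ->
  \sum_z sample_law d z * norm2 (td_step Q z - mean_td_step d Q) ^+ 2
  <= (reward_max M + (1 + discount M) * `|Q|) ^+ 2.
Proof.
move=> dd; set c := _ + _.
apply: (@le_trans _ _ (\sum_z sample_law d z * norm2 (td_step Q z) ^+ 2)).
  under eq_bigr => z _ do rewrite norm2_sqr mulr_sumr.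
  under [leRHS]eq_bigr => z _ do rewrite norm2_sqr mulr_sumr.
  rewrite exchange_big [leRHS]exchange_big /=; apply: ler_sum => i _.
  apply: le_trans (variance_le (fun z => td_step Q z i 0) dd).
  rewrite le_eqVlt; apply/orP; left; apply/eqP; apply: eq_bigr => z _.
  congr (_ * _ ^+ 2); rewrite mxE [X in _ + X]mxE summxE; congr (_ - _).
  by apply: eq_bigr => y _; rewrite mxE.
apply: mean_le => // z; rewrite norm2_sqr_sa.
rewrite (bigD1 z.1.1) //= [X in _ + X]big1 ?addr0; last first.
  move=> s /negPf sz; apply: big1 => a _.
  by rewrite of_saK sz mul0r expr0n.
rewrite (bigD1 z.1.2) //= [X in _ + X]big1 ?addr0; last first.
  by move=> a /negPf az; rewrite of_saK az andbF mul0r expr0n.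
rewrite of_saK !eqxx mul1r -real_normK ?num_real //.
have := norm_td_error_le Q z; rewrite -/c => tc.
by rewrite ler_sqr ?nnegrE // (le_trans _ tc).
Qed.

End Mdp.

(** * The Lyapunov function and its drift *)

Section Lyapunov.
Context {R : realType} {nS nA : nat} (M : mdp R nS nA).
Context (d : 'I_nS.+1 -> 'I_nA.+1 -> R) (alpha beta : R).
Implicit Types (x y : sa_vec R nS nA) (pi : det_policy nS nA).
Hypothesis beta_gt0 : 0 < beta.

Local Notation A := (switch_mx M d alpha).
Local Notation V := (lyap M d alpha beta).

Definition max_growth (l : nat) x : R :=
  \big[Num.max/0]_(pis : l.-tuple (det_policy nS nA))
    norm2 (mxprod [seq A pi | pi <- pis] *m x) ^+ 2.

Lemma le_max_growth l (pis : l.-tuple (det_policy nS nA)) x :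
  norm2 (mxprod [seq A pi | pi <- pis] *m x) ^+ 2 <= max_growth l x.
Proof.
exact: (le_bigmax _
  (fun s : l.-tuple _ => norm2 (mxprod [seq A pi | pi <- s] *m x) ^+ 2)).
Qed.

Lemma max_growth_le l x c : 0 <= c ->
  (forall pis : l.-tuple (det_policy nS nA),
    norm2 (mxprod [seq A pi | pi <- pis] *m x) ^+ 2 <= c) ->
  max_growth l x <= c.
Proof. by move=> c0 xc; apply: bigmax_le. Qed.

Lemma max_growth_ge0 l x : 0 <= max_growth l x.
Proof.
exact: le_trans (sqr_ge0 _) (le_max_growth (nseq_tuple l [ffun=> ord0]) x).
Qed.

Lemma max_growth0 x : max_growth 0 x = norm2 x ^+ 2.
Proof.
apply/eqP; rewrite eq_le; apply/andP; split.
  by apply: max_growth_le => [|pis]; rewrite ?sqr_ge0 // tuple0 /= mul1mx.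
by have := le_max_growth [tuple] x; rewrite /= mul1mx.
Qed.

Lemma max_growth_switch l pi x : max_growth l (A pi *m x) <= max_growth l.+1 x.
Proof.
apply: max_growth_le => [|pis]; first exact: max_growth_ge0.
(* [pi] goes in front because [mxprod] applies the head of the list first. *)
have := le_max_growth [tuple of pi :: pis] x.
by rewrite /= mxprod_cons mulmxA.
Qed.

Lemma max_growth_convex l (I : finType) (p : I -> R) (x : I -> sa_vec R nS nA) :
  is_distr p ->
  max_growth l (\sum_i p i *: x i) <= \sum_i p i * max_growth l (x i).
Proof.
move=> dp; apply: max_growth_le => [|pis].
  by apply: sumr_ge0 => i _; rewrite mulr_ge0 ?max_growth_ge0 // dp.1.
rewrite mulmx_sumr; under eq_bigr => i _ do rewrite -scalemxAr.
apply: le_trans (norm2_sqr_convex _ dp) _.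
by apply: ler_sum => i _; rewrite ler_wpM2l ?dp.1 ?le_max_growth.
Qed.

Lemma max_growth_young l e x y : 0 < e ->
  max_growth l (x + y)
  <= (1 + e) * max_growth l x + (1 + e^-1) * max_growth l y.
Proof.
move=> e0; have e1 : 0 <= 1 + e by rewrite addr_ge0 // ltW.
have e2 : 0 <= 1 + e^-1 by rewrite addr_ge0 // invr_ge0 ltW.
apply: max_growth_le => [|pis].
  by rewrite addr_ge0 // mulr_ge0 // max_growth_ge0.
rewrite mulmxDr (le_trans (norm2_sqr_young _ _ e0)) //.
by rewrite lerD // ler_wpM2l // le_max_growth.
Qed.

Let w_ge0 (l : nat) : 0 <= beta ^- (2 * l).
Proof. by rewrite invr_ge0 exprn_ge0 // ltW. Qed.

Lemma lyapE t x : V t x = \sum_(l < t.+1) beta ^- (2 * l) * max_growth l x.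
Proof. by []. Qed.

Lemma lyap_nondecreasing x : nondecreasing_seq (fun t => V t x).
Proof.
apply/nondecreasing_seqP => t; rewrite !lyapE [leRHS]big_ord_recr /= lerDl.
by rewrite mulr_ge0 ?max_growth_ge0.
Qed.

Lemma lyap_convex t (I : finType) (p : I -> R) (x : I -> sa_vec R nS nA) :
  is_distr p -> V t (\sum_i p i *: x i) <= \sum_i p i * V t (x i).
Proof.
move=> dp; rewrite lyapE; under [leRHS]eq_bigr => i _ do rewrite mulr_sumr.
rewrite exchange_big /=; apply: ler_sum => l _.
under [leRHS]eq_bigr => i _ do rewrite mulrCA.
by rewrite -mulr_sumr ler_wpM2l // max_growth_convex.
Qed.

Lemma lyap_young t e x y : 0 < e ->
  V t (x + y) <= (1 + e) * V t x + (1 + e^-1) * V t y.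
Proof.
move=> e0; rewrite !lyapE !mulr_sumr -big_split /=; apply: ler_sum => l _.
rewrite [(1 + e) * _]mulrCA [(1 + e^-1) * _]mulrCA -mulrDr.
by rewrite ler_wpM2l ?max_growth_young.
Qed.

(** An index shift: the term of rank l at M_pi x is dominated by the growth of rank l + 1 at x,
    whose weight is smaller by beta^2. The rank 0 term of x, its squared norm, is left over. *)
Lemma lyap_switch t pi x :
  V t (A pi *m x) <= beta ^+ 2 * (V t.+1 x - norm2 x ^+ 2).
Proof.
rewrite !lyapE [in leRHS]big_ord_recl /= muln0 expr0 invr1 mul1r max_growth0.
rewrite addrAC subrr add0r mulr_sumr; apply: ler_sum => l _.
have -> : beta ^- (2 * bump 0 l) = beta ^- 2 * beta ^- (2 * l).
  by rewrite mulnDr exprD invfM.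
rewrite !mulrA divff ?expf_neq0 ?gt_eqF // mul1r.
by rewrite ler_wpM2l // max_growth_switch.
Qed.

Lemma lyap_oo_cvg x : cvgn (fun t => (V t x)%:E).
Proof.
apply: ereal_nondecreasing_is_cvgn => t u tu.
by rewrite lee_fin; exact: lyap_nondecreasing.
Qed.

Lemma lyap_le_oo t x : ((V t x)%:E <= lyap_oo M d alpha beta x)%E.
Proof.
apply: lime_ge; first exact: lyap_oo_cvg.
exists t => // u /= tu; rewrite lee_fin; exact: lyap_nondecreasing.
Qed.

Lemma lyap_oo_le x c : (forall t, V t x <= c) ->
  (lyap_oo M d alpha beta x <= c%:E)%E.
Proof.
move=> xc; apply: lime_le; first exact: lyap_oo_cvg.
by apply: nearW => t; rewrite lee_fin.
Qed.

(* A sharper drift than the factor beta^2: the discarded term ||x||^2 is what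
   pays for the noise. *)
Lemma lyap_oo_mean_switch (w : det_policy nS nA -> R) x c : is_distr w ->
  (lyap_oo M d alpha beta x <= c%:E)%E ->
  (lyap_oo M d alpha beta (\sum_pi w pi *: (A pi *m x))
   <= (beta ^+ 2 * (c - norm2 x ^+ 2))%:E)%E.
Proof.
move=> dw xc; apply: lyap_oo_le => t; apply: le_trans (lyap_convex _ _ dw) _.
apply: mean_le => // pi; apply: le_trans (lyap_switch _ _ _) _.
rewrite ler_wpM2l ?sqr_ge0 // lerB // -lee_fin.
exact: le_trans (lyap_le_oo _ _) xc.
Qed.

Lemma lyap_oo_young e x y c c' : 0 < e ->
  (lyap_oo M d alpha beta x <= c%:E)%E ->
  (lyap_oo M d alpha beta y <= c'%:E)%E ->
  (lyap_oo M d alpha beta (x + y) <= ((1 + e) * c + (1 + e^-1) * c')%:E)%E.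
Proof.
move=> e0 xc yc; apply: lyap_oo_le => t.
apply: le_trans (lyap_young _ _ _ e0) _.
rewrite lerD // ler_wpM2l //.
- by rewrite addr_ge0 // ltW.
- by rewrite -lee_fin; exact: le_trans (lyap_le_oo _ _) xc.
- by rewrite addr_ge0 // invr_ge0 ltW.
- by rewrite -lee_fin; exact: le_trans (lyap_le_oo _ _) yc.
Qed.

Section EquivalentNorm.
Context (C : R).
Hypothesis C_ge1 : 1 <= C.
Hypothesis lyap_oo_bounds : forall x,
  ((norm2 x ^+ 2)%:E <= lyap_oo M d alpha beta x <= (C * norm2 x ^+ 2)%:E)%E.

(** The upper bound with [C] makes the extended limit finite, so the drift can be computed in
    [R]. *)
Definition lyap_limit x : R := fine (lyap_oo M d alpha beta x).
Local Notation v := lyap_limit.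

Lemma lyap_ooE x : lyap_oo M d alpha beta x = (v x)%:E.
Proof.
rewrite fineK // ge0_fin_numE; last first.
  by apply: le_trans (andP (lyap_oo_bounds x)).1; rewrite lee_fin sqr_ge0.
exact: le_lt_trans (andP (lyap_oo_bounds x)).2 (ltry _).
Qed.

Lemma lyap_limit_ge x : norm2 x ^+ 2 <= v x.
Proof. by have := lyap_oo_bounds x; rewrite lyap_ooE !lee_fin => /andP[]. Qed.

Lemma lyap_limit_le x : v x <= C * norm2 x ^+ 2.
Proof. by have := lyap_oo_bounds x; rewrite lyap_ooE !lee_fin => /andP[]. Qed.

Lemma lyap_limit_ge0 x : 0 <= v x.
Proof. exact: le_trans (sqr_ge0 _) (lyap_limit_ge x). Qed.

(* Young's inequality with weight 1 / (C - 1) loses exactly the factor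
   C / (C - 1) that the drift gains over beta^2, and leaves the factor C in
   front of the noise; no centring of the noise is involved. *)
Lemma lyap_limit_perturbed_drift (w : det_policy nS nA -> R) x u : is_distr w ->
  v (\sum_pi w pi *: (A pi *m x) + alpha *: u)
  <= beta ^+ 2 * v x + alpha ^+ 2 * C ^+ 2 * norm2 u ^+ 2.
Proof.
move=> dw; set y := \sum_pi _.
have vy : v y <= beta ^+ 2 * (v x - norm2 x ^+ 2).
  by rewrite -lee_fin -lyap_ooE; apply: lyap_oo_mean_switch; rewrite ?lyap_ooE.
have vau : v (alpha *: u) <= C * (alpha ^+ 2 * norm2 u ^+ 2).
  by rewrite -norm2Z_sqr; exact: lyap_limit_le.
have b2 : 0 <= beta ^+ 2 by exact: sqr_ge0.
have au : 0 <= alpha ^+ 2 * norm2 u ^+ 2 by rewrite mulr_ge0 // sqr_ge0.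
have vx := lyap_limit_le x; have vx0 := lyap_limit_ge0 x.
(* The Young weight 1 / (C - 1) needs C > 1. When C = 1, the upper bound on [v x] makes the drift
   bound nonpositive, which forces [y] to vanish. *)
have [C1|C1] := eqVneq C 1.
  have -> : y = 0.
    apply: norm2_sqr_eq0; apply: le_trans (lyap_limit_ge y) _.
    by rewrite (le_trans vy) // mulr_ge0_le0 // subr_le0 -[leRHS]mul1r -C1.
  rewrite add0r (le_trans vau) // C1 expr1n mulr1 mul1r lerDr.
  exact: mulr_ge0.
have {}C1 : 0 < C - 1 by rewrite subr_gt0 lt_neqAle eq_sym C1.
have Cn0 : C != 0 by rewrite gt_eqF // (lt_le_trans _ C_ge1).
have e0 : 0 < (C - 1)^-1 by rewrite invr_gt0.
have := @lyap_oo_young _ y (alpha *: u) (v y) (v (alpha *: u)) e0.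
rewrite !lyap_ooE !lee_fin => /(_ (lexx _) (lexx _)) /le_trans; apply.
have -> : 1 + (C - 1)^-1 = C / (C - 1) by field; rewrite gt_eqF.
rewrite invrK [1 + _]addrC subrK lerD //.
  (* Since the squared norm of [x] is at least v x / C, the drift factor is at most beta^2 (C - 1) /
     C, which cancels the Young weight. *)
  apply: (@le_trans _ _ (C / (C - 1) * (beta ^+ 2 * ((C - 1) / C * v x)))).
    rewrite ler_wpM2l ?divr_ge0 ?(ltW C1) ?(le_trans _ C_ge1) //.
    rewrite (le_trans vy) // ler_wpM2l //.
    have -> : (C - 1) / C * v x = v x - v x / C by field.
    by rewrite lerB // ler_pdivrMr ?(lt_le_trans _ C_ge1) // mulrC.
  rewrite le_eqVlt; apply/orP; left; apply/eqP; field.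
  by rewrite Cn0 gt_eqF.
(* One factor C is the second Young weight 1 + (C - 1), the other comes from the upper bound on
   [v]. *)
rewrite [leRHS](_ : _ = C * (C * (alpha ^+ 2 * norm2 u ^+ 2))); last by ring.
by rewrite ler_wpM2l // (le_trans _ C_ge1).
Qed.

(** The perturbed drift holds for each sample separately, with the same [w]; averaging over the
    samples then involves the noise only through its mean squared norm. *)
Lemma lyap_limit_q_update Q Qstar : bellman M Qstar = Qstar ->
  is_distr (sample_law M d) ->
  \sum_z sample_law M d z * v (q_update M alpha Q z - Qstar)
  <= beta ^+ 2 * v (Q - Qstar)
     + alpha ^+ 2 * C ^+ 2 * (reward_max M + (1 + discount M) * `|Q|) ^+ 2.
Proof.
move=> QstarE dd; have [w dw wE] := mean_step_error d alpha Q QstarE.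
set u := fun z => td_step M Q z - mean_td_step M d Q.
have uE z : q_update M alpha Q z - Qstar =
    \sum_pi w pi *: (A pi *m (Q - Qstar)) + alpha *: u z.
  rewrite q_updateE -wE; apply/sa_vecP => s a.
  by rewrite !(at_saD, at_saN, at_saZ); ring.
apply: (@le_trans _ _ (\sum_z sample_law M d z *
    (beta ^+ 2 * v (Q - Qstar) + alpha ^+ 2 * C ^+ 2 * norm2 (u z) ^+ 2))).
  apply: ler_sum => z _; rewrite ler_wpM2l ?dd.1 // uE.
  exact: lyap_limit_perturbed_drift.
under eq_bigr => z _ do rewrite mulrDr [_ * (_ * norm2 _ ^+ 2)]mulrCA.
rewrite big_split /= -mulr_suml dd.2 mul1r -mulr_sumr lerD2l.
by rewrite ler_wpM2l ?td_step_variance // mulr_ge0 // sqr_ge0.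
Qed.

End EquivalentNorm.
End Lyapunov.

(** * Expectations of functions of a finite-valued random variable *)

Section FiniteRandomVariable.
Context {R : realType} {disp : measure_display} {T : measurableType disp}.
Context (Pr : probability T R) {I : finType} (X : T -> I).
Hypothesis X_measurable : forall i, measurable [set w | X w = i].

Definition pmf (i : I) : R := fine (Pr [set w | X w = i]).

Lemma pmfE i : Pr [set w | X w = i] = (pmf i)%:E.
Proof. by rewrite fineK // fin_num_measure. Qed.

Lemma pmf_ge0 i : 0 <= pmf i.
Proof. by rewrite fine_ge0. Qed.

(** [f (X w)] is a finite combination of indicators of the level sets of [X]; nonnegativity allows
    exchanging sum and integral without an integrability argument. *)
Lemma integral_finite (f : I -> R) : (forall i, 0 <= f i) ->
  (\int[Pr]_w (f (X w))%:E)%E = (\sum_i pmf i * f i)%:E.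
Proof.
move=> f0; pose A i := [set w | X w = i].
have mA i : measurable (A i) by exact: X_measurable.
have fE w : (f (X w))%:E = (\sum_i (f i)%:E * (\1_(A i) w)%:E)%E.
  rewrite (bigD1 (X w)) //= big1 => [|i iX].
    by rewrite adde0 indicE mem_set // mule1.
  by rewrite indicE memNset ?mule0 // /A /= => Xi; rewrite Xi eqxx in iX.
under eq_integral => w _ do rewrite fE.
rewrite ge0_integral_sum //; last 2 first.
- move=> i; apply: measurable_funeM; apply/measurable_EFinP.
  exact: measurable_indic.
- by move=> i w _; rewrite mule_ge0 ?lee_fin.
rewrite -sumEFin; apply: eq_bigr => i _.
rewrite ge0_integralZl_EFin //; last first.
  by apply/measurable_EFinP; exact: measurable_indic.
by rewrite integral_indic // setIT EFinM -pmfE muleC.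
Qed.

Lemma pmf_distr : is_distr pmf.
Proof.
split; first exact: pmf_ge0.
have := @integral_finite (fun=> 1) (fun=> ler01).
by rewrite integral_cst //= mul1e probability_setT -mulr_suml mulr1 => -[].
Qed.

End FiniteRandomVariable.

(** * Conditioning on the observed history *)

Section Observations.
Context {R : realType} {nS nA : nat} (M : mdp R nS nA).
Context (d : 'I_nS.+1 -> 'I_nA.+1 -> R).
Context {disp : measure_display} {T : measurableType disp}.
Context (Pr : probability T R) (Z : nat -> T -> sample nS nA).
Hypothesis obs : iid_observations M d Pr Z.

(** The past is packed into a random variable of finite type, so that conditioning on it reduces to
    finite sums. *)
Definition history k w : {ffun 'I_k -> sample nS nA} :=
  [ffun i : 'I_k => Z i w].

Lemma historyP k (h : {ffun 'I_k -> sample nS nA}) w :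
  history k w = h <-> forall i : 'I_k, Z i w = h i.
Proof.
split=> [<- i|hE]; first by rewrite ffunE.
by apply/ffunP => i; rewrite ffunE hE.
Qed.

Lemma history_past k h : past_event Z k [set w | history k w = h].
Proof.
exists [set g | forall i, g i = h i]; apply/seteqP.
by split=> w /=; rewrite historyP.
Qed.

Lemma history_measurable k h : measurable [set w | history k w = h].
Proof.
have -> : [set w | history k w = h]
      = \bigcap_(i in [set: 'I_k]) [set w | Z i w = h i].
  apply/seteqP; split=> w /=; rewrite historyP => hE i; last exact: hE.
  by move=> _; exact: hE.
apply: fin_bigcap_measurable => // i _; exact: obs_measurable obs _ _.
Qed.

Definition extended_history k w := (history k w, Z k w).

Lemma extended_history_measurable k hz :
  measurable [set w | extended_history k w = hz].
Proof.
have -> : [set w | extended_history k w = hz]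
    = [set w | history k w = hz.1] `&` [set w | Z k w = hz.2].
  rewrite /extended_history; case: hz => h z.
  by apply/seteqP; split=> w /= [-> ->].
apply: measurableI; first exact: history_measurable.
exact: obs_measurable obs _ _.
Qed.

Lemma pmf_extended_history k h z :
  pmf Pr (extended_history k) (h, z) = pmf Pr (history k) h * sample_law M d z.
Proof.
apply: EFin_inj; rewrite -pmfE; last exact: extended_history_measurable.
rewrite EFinM -pmfE; last exact: history_measurable.
case: z => -[s a] s'; have hP := history_past h.
rewrite /sample_law /= EFinM muleA.
(* The two conditional laws are chained: the state-action pair given the history, then the next
   state given both. *)
rewrite -(obs_pair obs _ _ hP) -(obs_next obs _ _ _ hP).
congr (Pr _); apply/seteqP; split=> w /=; rewrite /extended_history.
  by case=> -> ->.
by case=> -[-> /= Zsa] Zs'; rewrite -Zsa -Zs' -surjective_pairing.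
Qed.

Lemma integral_extended_history k
    (f : {ffun 'I_k -> sample nS nA} -> sample nS nA -> R) :
  (forall h z, 0 <= f h z) ->
  (\int[Pr]_w (f (history k w) (Z k w))%:E)%E =
  (\sum_h pmf Pr (history k) h * \sum_z sample_law M d z * f h z)%:E.
Proof.
move=> f0.
have := @integral_finite _ _ _ Pr _ _ (@extended_history_measurable k)
  (fun hz => f hz.1 hz.2) (fun hz => f0 _ _).
move=> ->; congr (_%:E); under [RHS]eq_bigr => h _ do rewrite mulr_sumr.
rewrite pair_bigA /=; apply: eq_bigr => -[h z] _ /=.
by rewrite pmf_extended_history mulrA.
Qed.

Variables (alpha : R) (Q0 : sa_vec R nS nA).

(** The finite history is padded by a dummy sample at times from [k] on, which the first [k] updates
    never read. *)
Definition iterate_after k (h : {ffun 'I_k -> sample nS nA}) : sa_vec R nS nA :=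
  q_iter M alpha Q0
    (fun n => if insub n is Some i then h i else (ord0, ord0, ord0)) k.

Lemma q_iter_history k w :
  q_iter M alpha Q0 (Z ^~ w) k = iterate_after (history k w).
Proof.
apply: q_iter_eq => i ik; case: insubP => [j _ ji|]; last by rewrite ik.
by rewrite ffunE ji.
Qed.

Definition expected_iterate k (F : sa_vec R nS nA -> R) : R :=
  \sum_h pmf Pr (history k) h * F (iterate_after h).

Lemma integral_q_iter k (F : sa_vec R nS nA -> R) : (forall Q, 0 <= F Q) ->
  (\int[Pr]_w (F (q_iter M alpha Q0 (Z ^~ w) k))%:E)%E
  = (expected_iterate k F)%:E.
Proof.
move=> F0; under eq_integral => w _ do rewrite q_iter_history.
exact: (@integral_finite _ _ _ _ _ _ (@history_measurable k)
  (fun h => F (iterate_after h))).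
Qed.

Lemma expected_iterate0 F : expected_iterate 0 F = F Q0.
Proof.
rewrite /expected_iterate /iterate_after /= -mulr_suml.
by rewrite (pmf_distr Pr (@history_measurable 0)).2 mul1r.
Qed.

(** The tower property. Passing through the integral avoids comparing histories of length k + 1 with
    pairs of a history of length k and a new sample. *)
Lemma expected_iterateS k (F : sa_vec R nS nA -> R) : (forall Q, 0 <= F Q) ->
  expected_iterate k.+1 F =
  expected_iterate k
    (fun Q => \sum_z sample_law M d z * F (q_update M alpha Q z)).
Proof.
move=> F0; apply: EFin_inj; rewrite -integral_q_iter //=.
under eq_integral => w _ do rewrite q_iter_history.
exact: (@integral_extended_history k
  (fun h z => F (q_update M alpha (iterate_after h) z))).
Qed.

Lemma expected_iterate_distr k : is_distr (pmf Pr (history k)).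
Proof. exact: pmf_distr (@history_measurable k). Qed.

End Observations.

(** * The scalar recurrence and the final bounds *)

Lemma affine_recurrence_le {R : realFieldType} (e : nat -> R) (b K : R) :
  0 <= b < 1 -> (forall k, e k.+1 <= b * e k + K) ->
  forall k, e k <= b ^+ k * e 0%N + K / (1 - b) * (1 - b ^+ k).
Proof.
move=> /andP[b0 b1] eS; have b10 : 1 - b != 0 by rewrite subr_eq0 gt_eqF.
elim=> [|k IH]; first by rewrite expr0 subrr mulr0 addr0 mul1r.
apply: le_trans (eS k) _.
apply: (@le_trans _ _ (b * (b ^+ k * e 0%N + K / (1 - b) * (1 - b ^+ k)) + K)).
  by rewrite lerD2r ler_wpM2l.
by rewrite exprS le_eqVlt; apply/orP; left; apply/eqP; field.
Qed.

Theorem theorem2 (R : realType) (nS nA : nat) (M : mdp R nS nA)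
  (p : 'I_nS.+1 -> R) (b : 'I_nS.+1 -> 'I_nA.+1 -> R)
  (alpha eps C : R) (Q0 Qstar : sa_vec R nS nA)
  (disp : measure_display) (T : measurableType disp) (Pr : probability T R)
  (Z : nat -> T -> sample nS nA) :
  let d := visit p b in
  let beta := joint_spectral_radius (range (switch_mx M d alpha)) + eps in
  let Vinf := lyap_oo M d alpha beta in
  let Wmax := noise_bound M Q0 in
  let Q := fun k w => q_iter M alpha Q0 (Z ^~ w) k in
  is_distr p -> (forall s, is_distr (b s)) ->
  (forall s a, 0 < d s a) ->
  0 < alpha < 1 ->
  bellman M Qstar = Qstar ->
  iid_observations M d Pr Z ->
  0 < eps -> beta < 1 ->
  1 <= C ->
  (forall x : sa_vec R nS nA,
    ((norm2 x ^+ 2)%:E <= Vinf x <= (C * norm2 x ^+ 2)%:E)%E) ->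
  (forall k : nat,
    (\int[Pr]_w Vinf (Q k w - Qstar)%R <=
      (beta ^+ (2 * k))%:E * Vinf (Q0 - Qstar)%R
      + (alpha ^+ 2 * C ^+ 2 * Wmax / (1 - beta ^+ 2)
         * (1 - beta ^+ (2 * k)))%:E)%E)
  /\
  (forall k : nat,
    ('E_Pr[fun w => `|Q k w - Qstar|%R] <=
      (Num.sqrt C * beta ^+ k * norm2 (Q0 - Qstar)
       + alpha * C * Num.sqrt (Wmax / (1 - beta ^+ 2)))%:E)%E).
Proof.
move=> d beta Vinf Wmax Q dp db _ /andP[a0 a1] QstarE obs eps0 beta1 C1 Vbounds.
have beta0 : 0 < beta by rewrite ltr_wpDl // joint_spectral_radius_ge0.
have dd : is_distr (sample_law M d) by exact: sample_law_distr.
pose v := lyap_limit M d alpha beta.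
have VE x : Vinf x = (v x)%:E by exact: lyap_ooE Vbounds x.
have v0 x : 0 <= v x by exact: lyap_limit_ge0 Vbounds x.
pose K := alpha ^+ 2 * C ^+ 2 * Wmax.
pose E k F := expected_iterate M Pr Z alpha Q0 k F.
pose e k := E k (fun q => v (q - Qstar)).
have g0 := ltW (discount_gt0 M).
have b2 : beta ^+ 2 < 1 by rewrite expr_lt1 // ltW.
have eS k : e k.+1 <= beta ^+ 2 * e k + K.
  rewrite /e /E (expected_iterateS obs) //.
  have pd := expected_iterate_distr obs k.
  (* [K] is spread over the histories, whose masses sum to 1, so that the inequality can be checked
     history by history. *)
  rewrite /expected_iterate -[K]mul1r -pd.2 mulr_suml mulr_sumr -big_split /=.
  apply: ler_sum => h _; rewrite mulrCA -mulrDr ler_wpM2l ?pd.1 //.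
  apply: (le_trans (lyap_limit_q_update beta0 C1 Vbounds _ QstarE dd)).
  (* The noise bound still depends on the current iterate; the uniform bound on all iterates
     replaces it by [Wmax]. *)
  rewrite lerD2l ler_wpM2l //; first by rewrite mulr_ge0 // sqr_ge0.
  have rm0 := reward_max_ge0 M.
  rewrite /Wmax /noise_bound ler_sqr ?nnegrE; last 2 first.
  - by rewrite addr_ge0 // mulr_ge0 // addr_ge0.
  - by rewrite addr_ge0 // mulr_ge0 ?addr_ge0 // le_max normr_ge0.
  by rewrite lerD2l ler_wpM2l ?addr_ge0 // q_iter_norm_le // ltW //= ltW.
have e0 : e 0%N = v (Q0 - Qstar) by exact: (expected_iterate0 obs).
have eb k : e k <= beta ^+ (2 * k) * v (Q0 - Qstar)
    + K / (1 - beta ^+ 2) * (1 - beta ^+ (2 * k)).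
  by rewrite exprM -e0; apply: affine_recurrence_le; rewrite ?sqr_ge0.
have EE k F : (forall q, 0 <= F q) ->
    (\int[Pr]_w (F (Q k w))%:E)%E = (E k F)%:E.
  by move=> F0; exact: integral_q_iter obs _ _ _ _ F0.
split=> k.
  under eq_integral => w _ do rewrite VE.
  rewrite VE -EFinM -EFinD (EE k (fun q => v (q - Qstar))) // lee_fin.
  exact: eb.
rewrite unlock (EE k (fun q => `|q - Qstar|)) // lee_fin.
have W0 : 0 <= Wmax / (1 - beta ^+ 2).
  by rewrite divr_ge0 ?sqr_ge0 // subr_ge0 ltW.
have C0 : 0 <= C by exact: le_trans C1.
set A := Num.sqrt C * _ * _; set B := alpha * C * _.
have A0 : 0 <= A by rewrite !mulr_ge0 ?sqrtr_ge0 // exprn_ge0 // ltW.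
have B0 : 0 <= B by rewrite !mulr_ge0 ?sqrtr_ge0 // ltW.
have pd := expected_iterate_distr obs k.
(* Squares are compared: the squared mean is at most the mean square, the sup norm is at most the
   Euclidean norm, and the latter squared is at most [v]. *)
rewrite -ler_sqr ?nnegrE ?addr_ge0 //; last first.
  by apply: sumr_ge0 => h _; rewrite mulr_ge0 // pd.1.
apply: le_trans (sqr_mean_le _ pd) _.
apply: (@le_trans _ _ (e k)).
  apply: ler_sum => h _; rewrite ler_wpM2l ?pd.1 //.
  exact: le_trans (mx_norm_le_norm2 _) (lyap_limit_ge Vbounds _).
apply: le_trans (eb k) _.
(* [A] squared dominates the decaying term through [v] at most [C] times the squared norm, [B]
   squared dominates the noise term because 1 - beta^(2k) is at most 1, and the cross term 2AB is
   nonnegative. *)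
apply: (@le_trans _ _ (A ^+ 2 + B ^+ 2)); last first.
  by rewrite sqrrD -addrA lerD2l lerDr mulrn_wge0 // mulr_ge0.
rewrite lerD //.
  rewrite /A !exprMn sqr_sqrtr // -exprM mulnC [C * _]mulrC -mulrA.
  by rewrite ler_wpM2l ?exprn_ge0 ?(ltW beta0) // lyap_limit_le.
rewrite /B !exprMn sqr_sqrtr // /K -[_ * Wmax / _]mulrA ler_piMr //.
  by rewrite mulr_ge0 // mulr_ge0 // sqr_ge0.
by rewrite gerBl exprn_ge0 // ltW.
Qed.
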